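(* Let $\mathscr{B}=\{b_k:k\ge1\}\subset\{2,3,\dots\}$ be such that $b_k=a_k^2$ with integers $a_k$ such that $a_k$ and $a_{k'}$ are relatively prime for $k\ne k'$, and let $z=\boldsymbol{\mu}_{\mathscr{B}}$ (this includes the case where $z=\boldsymbol{\mu}$ is the classical Möbius function, corresponding to $\mathscr{B}$ being the set of squares of all primes). Then for every $\varepsilon>0$ there exists a Toeplitz sequence $t=(t_n)_{n\in\mathbb{N}^*}\in\{-1,0,1\}^{\mathbb{N}^*}$ such that $$\liminf_{N\to\infty}\frac1N\sum_{n\le N}t_n\,z(n)>0\quad\text{and}\quad h_{top}(t)\ge(1-\varepsilon)\,h_{top}(z^2).$$
   Context: $\mathbb{N}^*=\{1,2,3,\dots\}$; sums $\sum_{n\le N}$ are over $1\le n\le N$; logarithms are to base $2$. For $n\in\mathbb{N}^*$ set $\eta_{\mathscr{B}}(n)=0$ if $b_k\mid n$ for some $k\ge1$ and $\eta_{\mathscr{B}}(n)=1$ otherwise, set $\delta(n):=|\{k\ge1: a_k\mid n\}|$, and define $\boldsymbol{\mu}_{\mathscr{B}}(n):=(-1)^{\delta(n)}\eta_{\mathscr{B}}(n)$. For a sequence $w\in A^{\mathbb{N}^*}$ over a finite alphabet $A$, $h_{top}(w):=\lim_{n\to\infty}\frac1n\log p_n(w)$, where $p_n(w)$ is the number of distinct blocks of length $n$ appearing in $w$. $z^2$ denotes the sequence $(z(n)^2)_{n\in\mathbb{N}^*}$. A sequence $t\in A^{\mathbb{N}^*}$ is Toeplitz if for each $a\in\mathbb{N}^*$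 there exists $r_a\in\mathbb{N}^*$ such that $t(a)=t(a+kr_a)$ for every $k\in\mathbb{N}^*$. *)

(* Defs.v *)
From HB Require Import structures.
From mathcomp Require Import all_boot all_order all_algebra.
From mathcomp Require Import finmap.
From mathcomp Require Import all_classical all_reals all_analysis.

Set Implicit Arguments.
Unset Strict Implicit.
Unset Printing Implicit Defensive.

Import Order.TTheory GRing.Theory Num.Theory.
Import numFieldNormedType.Exports.

Local Open Scope classical_set_scope.
Local Open Scope ring_scope.

(* A sequence indexed by N^* = {1, 2, ...} is a function on nat whose value
   at 0 is ignored. The families (a_k) and (b_k), k >= 1, are indexed by
   k : nat, i.e. with index shifted by one; the index is only a label. *)

Definition eta (b : nat -> nat) (n : nat) : int :=
  if `[< exists k, (b k %| n)%N >] then 0 else 1.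

(* [fset_set] of an infinite set is empty; for n >= 1 the set below is finite
   as soon as the `|a k| >= 2 are pairwise coprime. *)
Definition delta (a : nat -> int) (n : nat) : nat :=
  #|` fset_set [set k | (a k %| n%:Z)%Z]|.

Definition muB (a : nat -> int) (b : nat -> nat) (n : nat) : int :=
  (-1) ^+ delta a n * eta b n.

Definition blocks (A : choiceType) (w : nat -> A) (n : nat) : set (seq A) :=
  [set mkseq (fun j => w (i + j)%N) n | i in [set i | (0 < i)%N]].

(* Meaningful for sequences w with finitely many values, so that the set of
   blocks is finite. *)
Definition complexity (A : choiceType) (w : nat -> A) (n : nat) : nat :=
  #|` fset_set (blocks w n)|.

Definition log2 (R : realType) (x : R) : R := ln x / ln 2.

Definition htop (R : realType) (A : choiceType) (w : nat -> A) : R :=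
  limn (fun n => n%:R^-1 * log2 (complexity w n)%:R : R).

Definition toeplitz (A : Type) (t : nat -> A) : Prop :=
  forall n, (0 < n)%N -> exists r, (0 < r)%N /\
    forall k, (0 < k)%N -> t n = t (n + k * r)%N.

(* Main.v *)
Require Import Defs.
From mathcomp Require Import all_boot all_order all_algebra.
From mathcomp Require Import finmap.
From mathcomp Require Import all_classical all_reals all_analysis.
From mathcomp Require Import ring lra zify.

(* The sequence t is built in stages: at stage j the still undefined places of
   an initial window [0, L_j) are filled and repeated with a period r_j, a
   multiple of r_(j-1).  The window mostly copies z, and since sum_j L_j / r_j is
   small, t agrees with z outside a set of small upper density; so t correlates
   with z as soon as the support of z has positive lower density, and it does
   because the multiples of squares m^2, m >= 2, have upper density at most
   1/4 + 1/2.  The last, relatively short, part of the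
   window does not copy z but runs through all binary patterns on a period
   r_(j-1); almost all residues modulo r_(j-1) are still free at stage j, so t
   has entropy close to 1, whereas z^2 is binary and has entropy at most 1. *)

Set Implicit Arguments.
Unset Strict Implicit.
Unset Printing Implicit Defensive.

Import Order.TTheory GRing.Theory Num.Theory.
Import numFieldNormedType.Exports.
Local Open Scope classical_set_scope.
Local Open Scope ring_scope.

(** * Counting integers with small residue *)

Section Counting.
Local Open Scope nat_scope.

Lemma count_has_le (T I : Type) (P : I -> pred T) (r : seq I) (s : seq T) :
  count (fun x => has (fun i => P i x) r) s <= \sum_(i <- r) count (P i) s.
Proof.
elim: r => [|i r IH] /=; first by rewrite (eq_count (a2 := pred0)) ?count_pred0.
rewrite big_cons (leq_trans _ (leq_add (leqnn _) IH))//.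
by rewrite -count_predUI leq_addr.
Qed.

Lemma sub_in_count (T : eqType) (p q : pred T) (s : seq T) :
  {in s, subpred p q} -> count p s <= count q s.
Proof.
move=> pq; rewrite (eq_in_count (a2 := predI p q)); last first.
  by move=> x xs /=; case: (boolP (p x)) => // /(pq x xs) ->.
by apply: sub_count => x /andP[].
Qed.

Lemma size_residue (s qs : seq nat) (d L : nat) : uniq s ->
  {in s, forall n, n %% d < L /\ n %/ d \in qs} -> size s <= size qs * L.
Proof.
move=> us sP; rewrite -[in leqRHS](size_iota 0 L).
rewrite -(size_allpairs (fun q x => q * d + x)).
apply: uniq_leq_size => // n /sP[nL nqs]; rewrite (divn_eq n d).
by apply: (allpairs_f (fun q x => q * d + x)) => //; rewrite mem_iota.
Qed.

(** A number is determined by its quotient and residue, and only [N %/ d] quotients are allowed, so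
    there is no boundary error. The shift [c] is 1 when quotient 0 is excluded and 0 for a full
    range of residues. *)
Lemma count_residue_le (R : realFieldType) (s : seq nat) (c d L N : nat) :
  0 < d -> uniq s ->
  {in s, forall n, n %% d < L -> c <= n %/ d < c + N %/ d} ->
  ((count (fun n => n %% d < L) s)%N%:R <= N%:R * (L%:R / d%:R) :> R)%R.
Proof.
move=> d0 us sP.
have : count (fun n => n %% d < L) s <= N %/ d * L.
  rewrite -size_filter -[in leqRHS](size_iota c (N %/ d)).
  apply: (@size_residue _ _ d); first exact: filter_uniq.
  move=> n; rewrite mem_filter => /andP[nL ns]; split=> //.
  by rewrite mem_iota sP.
rewrite -(ler_nat R) natrM => /le_trans; apply.
rewrite mulrCA [leRHS]mulrC ler_wpM2r// ?ler0n//.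
by rewrite ler_pdivlMr ?ltr0n// -natrM ler_nat leq_divM.
Qed.

End Counting.

(** * Construction of the Toeplitz sequence *)

Section Construction.
Local Open Scope nat_scope.
Variables (C : nat) (z : nat -> int).

(* [period j] is the common period of the stages before j; stage j fills the
   residues below [window j] modulo [period j.+1].  With these choices both
   [window j / period j.+1] and [chunk j / (window j - chunk j)] are
   [1 / sparsity j]. *)
Definition sparsity (j : nat) : nat := C.+1 * 2 ^ j.+1.

Fixpoint period (j : nat) : nat :=
  if j is i.+1 then sparsity i * ((sparsity i).+1 * (period i * 2 ^ period i))
  else 1.

(** Room for one word of length [period j] per subset of the residues modulo [period j]. *)
Definition chunk (j : nat) : nat := period j * 2 ^ period j.

Definition window (j : nat) : nat := (sparsity j).+1 * chunk j.

Lemma periodS j : period j.+1 = sparsity j * window j. Proof. by []. Qed.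

Lemma sparsity_gt1 j : 1 < sparsity j.
Proof.
have : 0 < 2 ^ j by rewrite expn_gt0.
by rewrite /sparsity expnS; nia.
Qed.

Lemma sparsity_gt0 j : 0 < sparsity j.
Proof. exact: ltnW (sparsity_gt1 j). Qed.

Lemma lt_period j : j < period j.
Proof.
elim: j => // j IH; rewrite periodS /window /chunk.
have h : j < period j * 2 ^ period j by rewrite (leq_trans IH)// leq_pmulr// expn_gt0.
have := sparsity_gt1 j; nia.
Qed.

Lemma period_gt0 j : 0 < period j. Proof. exact: leq_trans (lt_period j). Qed.

Lemma chunk_gt0 j : 0 < chunk j.
Proof. by rewrite muln_gt0 period_gt0 expn_gt0. Qed.

Lemma windowE j : window j = sparsity j * chunk j + chunk j.
Proof. by rewrite /window mulSn addnC. Qed.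

Lemma period_le_chunk j : period j <= chunk j.
Proof. by rewrite leq_pmulr// expn_gt0. Qed.

Lemma lt_window j : j < window j.
Proof.
rewrite windowE (leq_trans (lt_period j))//.
by rewrite (leq_trans (period_le_chunk j))// leq_addl.
Qed.

Lemma window_le_period j : window j <= period j.+1.
Proof. by rewrite periodS leq_pmull// sparsity_gt0. Qed.

Lemma dvd_period i j : i <= j -> period i %| period j.
Proof.
elim: j => [|j IH]; first by rewrite leqn0 => /eqP->.
rewrite leq_eqVlt => /predU1P[->//|/IH /dvdn_trans]; apply.
by rewrite periodS /window /chunk !mulnA dvdn_mulr// dvdn_mull.
Qed.

Lemma dvd_period_chunk j : period j %| chunk j.
Proof. exact: dvdn_mulr. Qed.

Lemma stage_exists n : exists j, n %% period j.+1 < window j.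
Proof.
exists n; rewrite modn_small ?lt_window//.
exact: leq_trans (lt_window n) (window_le_period n).
Qed.

Definition stage (n : nat) : nat := ex_minn (stage_exists n).

Lemma stage_window n : n %% period (stage n).+1 < window (stage n).
Proof. by rewrite /stage; case: ex_minnP. Qed.

Lemma stage_eq n j : n %% period j.+1 < window j ->
  (forall i, i < j -> window i <= n %% period i.+1) -> stage n = j.
Proof.
move=> nj small; rewrite /stage; case: ex_minnP => k nk kmin.
apply/eqP; rewrite eqn_leq kmin// leqNgt.
by apply/negP => /small; rewrite leqNgt nk.
Qed.

Lemma stage_lt n i : i < stage n -> window i <= n %% period i.+1.
Proof.
rewrite /stage; case: ex_minnP => k nk kmin ik; rewrite leqNgt.
by apply/negP => /kmin; rewrite leqNgt ik.
Qed.

(** The number [q] codes a subset of ['I_P] by its rank in the enumeration; the default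
    [finset.set0] is reached only for [q] at least [2 ^ P]. *)
Definition pattern_bit (P q y : nat) : bool :=
  y \in map val (enum (nth finset.set0 (enum {set 'I_P}) q)).

Definition fill (j x : nat) : int :=
  if x < sparsity j * chunk j then z x
  else (pattern_bit (period j) ((x - sparsity j * chunk j) %/ period j)
         (x %% period j))%:Z.

Definition toeplitz_approx (n : nat) : int :=
  fill (stage n) (n %% period (stage n).+1).

(** The periods divide one another, so the shift preserves the residues modulo [period i.+1] for all
    [i <= stage n], and these decide the stage. *)
Lemma stageD n k : stage (n + k * period (stage n).+1) = stage n.
Proof.
have e i : i <= stage n ->
    (n + k * period (stage n).+1) %% period i.+1 = n %% period i.+1.
  move=> le_i; rewrite -modnDmr.
  have /eqP-> : period i.+1 %| k * period (stage n).+1.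
    by rewrite dvdn_mull// dvd_period.
  by rewrite addn0.
apply: stage_eq; first by rewrite e// stage_window.
by move=> i ij; rewrite e ?(ltnW ij)// stage_lt.
Qed.

Lemma toeplitz_toeplitz_approx : toeplitz toeplitz_approx.
Proof.
move=> n n0; exists (period (stage n).+1); split; first exact: period_gt0.
by move=> k _; rewrite /toeplitz_approx stageD addnC modnMDl.
Qed.

Lemma toeplitz_approx_range (V : seq int) : {subset [:: 0%R; 1%R] <= V} ->
  (forall n, z n \in V) -> forall n, toeplitz_approx n \in V.
Proof.
move=> V01 zV n; rewrite /toeplitz_approx /fill; case: ifP => // _.
by apply: V01; case: pattern_bit.
Qed.

(** In the copying part of the first occurrence of a window the value is [z n] itself. A mismatch
    thus lies in a later repetition or in the pattern chunk. *)
Lemma toeplitz_approx_eq n : toeplitz_approx n != z n ->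
  exists2 j, j <= n & (period j.+1 <= n) && (n %% period j.+1 < window j) ||
                      (sparsity j * chunk j <= n < window j).
Proof.
set j := stage n => ne; exists j.
  rewrite leqNgt; apply/negP => /stage_lt; rewrite leqNgt => /negP; apply.
  exact: leq_ltn_trans (leq_mod _ _) (lt_window n).
rewrite (stage_window n) -/j andbT.
have [//|nj] := leqP (period j.+1) n.
have := stage_window n; rewrite -/j (modn_small nj) => ->.
rewrite andbT leqNgt; apply: contra ne => h.
by rewrite /toeplitz_approx -/j (modn_small nj) /fill h.
Qed.

(** * Frequency of the mismatches with [z] *)

Section Density.
Variable R : realFieldType.

Lemma sum_inv_sparsity n :
  (\sum_(i < n) (sparsity i)%:R^-1 <= C.+1%:R^-1 :> R)%R.
Proof.
have -> : (\sum_(i < n) (sparsity i)%:R^-1 = C.+1%:R^-1 * (1 - 2%:R^-1 ^+ n) :> R)%R.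
  elim: n => [|n IH]; first by rewrite big_ord0 expr0 subrr mulr0.
  rewrite big_ord_recr/= IH /sparsity natrM natrX invfM -exprVn !exprS.
  by move: (_ ^+ n)%R (C.+1%:R^-1)%R => p c; field.
rewrite ler_piMr ?invr_ge0 ?ler0n// gerBl exprn_ge0// invr_ge0 ler0n//.
Qed.

Lemma window_ratio j : (window j)%:R / (period j.+1)%:R = (sparsity j)%:R^-1 :> R.
Proof.
rewrite periodS natrM invfM mulrCA mulfV ?mulr1//.
by rewrite pnatr_eq0 -lt0n (leq_trans _ (lt_window j)).
Qed.

Lemma count_mismatch N :
  ((count (fun n => toeplitz_approx n != z n) (iota 1 N))%N%:R
     <= N%:R * (2 / C.+1%:R) :> R)%R.
Proof.
pose A j n := (period j.+1 <= n) && (n %% period j.+1 < window j).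
pose B j n := sparsity j * chunk j <= n < window j.
have cA j : ((count (A j) (iota 1 N))%N%:R <= N%:R * (sparsity j)%:R^-1 :> R)%R.
  rewrite -window_ratio.
  have -> : count (A j) (iota 1 N) = count (fun n => n %% period j.+1 < window j)
      [seq n <- iota 1 N | period j.+1 <= n].
    by rewrite count_filter; apply: eq_count => n; rewrite /A /= andbC.
  (* The condition [period j.+1 <= n] excludes quotient 0 and leaves the quotients from 1 to
     [N %/ period j.+1]. *)
  apply: (@count_residue_le _ _ 1); first exact: period_gt0.
    by rewrite filter_uniq// iota_uniq.
  move=> n; rewrite mem_filter mem_iota add1n ltnS => /and3P[pn _ nN] _.
  by rewrite divn_gt0 ?period_gt0// pn/= ltnS leq_div2r.
have cB j : ((count (B j) (iota 1 N))%N%:R <= N%:R * (sparsity j)%:R^-1 :> R)%R.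
  rewrite ler_pdivlMr ?ltr0n ?sparsity_gt0// -natrM ler_nat.
  (* The chunk starts at [sparsity j] times its own length: a smaller [N] does not meet it, and a
     larger one outweighs it. *)
  have [NM|MN] := ltnP N (sparsity j * chunk j).
    rewrite (eq_in_count (a2 := pred0)) ?count_pred0// => n.
    rewrite mem_iota add1n ltnS => /andP[_ nN].
    by rewrite /B/= leqNgt (leq_ltn_trans nN NM).
  apply: leq_trans MN; rewrite mulnC leq_pmul2l ?sparsity_gt0//.
  rewrite -size_filter -(size_iota (sparsity j * chunk j) (chunk j)).
  apply: uniq_leq_size; first by rewrite filter_uniq// iota_uniq.
  by move=> n; rewrite mem_filter !mem_iota /B windowE => /andP[].
have h : count (fun n => toeplitz_approx n != z n) (iota 1 N) <=
    \sum_(j <- index_iota 0 N.+1) (count (A j) (iota 1 N) + count (B j) (iota 1 N)).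
  apply: (@leq_trans (\sum_(j <- index_iota 0 N.+1)
      count (fun n => A j n || B j n) (iota 1 N))); last first.
    by apply: leq_sum => j _; rewrite -count_predUI leq_addr.
  apply: (leq_trans _ (count_has_le (fun j n => A j n || B j n) _ _)).
  apply: sub_in_count => n; rewrite mem_iota add1n ltnS => /andP[_ nN].
  case/toeplitz_approx_eq => j jn AB; apply/hasP; exists j => //.
  by rewrite mem_index_iota/= ltnS (leq_trans jn).
move: h; rewrite -(ler_nat R) => /le_trans; apply.
rewrite natr_sum big_mkord.
apply: le_trans (_ : \sum_(j < N.+1) (2 * N%:R) * (sparsity j)%:R^-1 <= _)%R.
  by apply: ler_sum => j _; have := cA j; have := cB j; rewrite natrD; lra.
rewrite -mulr_sumr mulrCA -mulrA ler_wpM2l// ?ler_wpM2l ?ler0n//.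
exact: sum_inv_sparsity.
Qed.

End Density.

(** * Free residues and the words they carry *)

Definition free_set (j : nat) : {set 'I_(period j)} :=
  [set y : 'I_(period j) | all (fun i => window i <= y %% period i.+1) (iota 0 j)]%SET.

(** For [i < j] the period of stage [i] divides [period j], so that stage takes a proportion
    [1 / sparsity i] of the residues; these proportions are summed. *)
Lemma card_free_set (R : realFieldType) j :
  ((period j)%:R * (1 - C.+1%:R^-1) <= #|free_set j|%:R :> R)%R.
Proof.
pose bad := fun y => has (fun i => y %% period i.+1 < window i) (iota 0 j).
have e : #|free_set j| + count bad (iota 0 (period j)) = period j.
  have -> : #|free_set j| = count (predC bad) (iota 0 (period j)).
    rewrite cardE -val_enum_ord count_map -size_filter enumT.
    congr size; apply: eq_filter => y /=; rewrite inE /bad -all_predC.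
    by apply: eq_all => i /=; rewrite leqNgt.
  by rewrite addnC count_predC size_iota.
have : ((count bad (iota 0 (period j)))%N%:R <= (period j)%:R * C.+1%:R^-1 :> R)%R.
  have := count_has_le (fun i y => y %% period i.+1 < window i) (iota 0 j)
    (iota 0 (period j)).
  rewrite -(ler_nat R) => /le_trans; apply; rewrite natr_sum.
  apply: le_trans (_ : \sum_(i <- iota 0 j) (period j)%:R * (sparsity i)%:R^-1 <= _)%R.
    rewrite [leLHS]big_seq [leRHS]big_seq; apply: ler_sum => i.
    rewrite mem_iota add0n => /andP[_ ij]; rewrite -window_ratio.
    apply: (@count_residue_le _ _ 0); [exact: period_gt0|exact: iota_uniq|].
    move=> y; rewrite mem_iota !add0n => /andP[_ yj] _.
    rewrite leq0n ltn_divLR ?period_gt0// divnK//; exact: dvd_period.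
  rewrite -mulr_sumr ler_wpM2l ?ler0n//.
  have := sum_inv_sparsity R j.
  by rewrite -(big_mkord xpredT (fun i => (sparsity i)%:R^-1)%R) /index_iota subn0.
have : (#|free_set j|%:R + (count bad (iota 0 (period j)))%N%:R = (period j)%:R :> R)%R.
  by rewrite -natrD e.
by move=> eq bad_le; rewrite mulrBr mulr1 lerBlDr -[X in (X <= _)%R]eq lerD2l.
Qed.

(** The offset before [y] is a multiple of [period j], so earlier stages see this place as [y],
    which they leave free; stage [j] then writes the pattern there. *)
Lemma toeplitz_approx_pattern j q (y : 'I_(period j)) :
  q < 2 ^ period j -> y \in free_set j ->
  toeplitz_approx (sparsity j * chunk j + q * period j + y) =
  (pattern_bit (period j) q y)%:Z.
Proof.
move=> qj; rewrite inE => /allP yfree.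
set n := sparsity j * chunk j + q * period j + y.
have nlt : n < window j.
  rewrite windowE /n -addnA ltn_add2l.
  have : q.+1 * period j <= chunk j by rewrite /chunk mulnC leq_pmul2l ?period_gt0.
  by apply: leq_trans; rewrite mulSn addnC ltn_add2r.
have nsmall : n %% period j.+1 = n.
  by rewrite modn_small// (leq_trans nlt)// window_le_period.
have nmod d : d %| period j -> n %% d = y %% d.
  move=> dp; rewrite /n -modnDml.
  have /eqP-> : d %| sparsity j * chunk j + q * period j; last by rewrite add0n.
  rewrite dvdn_add// dvdn_mull//.
  exact: dvdn_trans dp (dvd_period_chunk j).
have js : stage n = j.
  apply: stage_eq; first by rewrite nsmall.
  move=> i ij; rewrite nmod ?dvd_period// yfree// mem_iota//.
rewrite /toeplitz_approx js nsmall /fill ltnNge /n -addnA leq_addr/= addKn.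
rewrite divnMDl ?period_gt0// divn_small// addn0 addnA.
by rewrite -/n nmod// modn_small.
Qed.

(** Each subset of the free residues is used as a pattern, and the word written for it shows the
    subset at the free residues. *)
Lemma toeplitz_approx_words j : exists s : seq (seq int),
  [/\ uniq s, size s = 2 ^ #|free_set j|
   & {in s, forall v, blocks toeplitz_approx (period j) v}].
Proof.
pose E := enum {set 'I_(period j)}.
pose loc A := sparsity j * chunk j + index A E * period j.
pose f A := mkseq (fun y => toeplitz_approx (loc A + y)) (period j).
have idx A : index A E < 2 ^ period j.
  have : index A E < size E by rewrite index_mem mem_enum.
  by rewrite -cardE -cardsT -powersetT card_powerset cardsT card_ord.
exists [seq f A | A <- enum (powerset (free_set j))]; split.
- rewrite map_inj_in_uniq ?enum_uniq// => A B; rewrite !mem_enum !inE.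
  move=> AF BF fAB.
  have bitP X y : y \in free_set j ->
      nth 0%R (f X) (val y) = (y \in X)%:Z :> int.
    move=> yF; rewrite nth_mkseq//= toeplitz_approx_pattern//.
    rewrite /pattern_bit nth_index ?mem_enum//.
    by rewrite (mem_map val_inj) mem_enum.
  apply/setP => y; have [yF|yF] := boolP (y \in free_set j).
    have := bitP A y yF; rewrite fAB bitP//.
    by case: (y \in A); case: (y \in B).
  (* Outside the free residues the words give no information, but neither subset has elements
     there. *)
  rewrite (contraNF (fintype.subsetP AF y) yF) (contraNF (fintype.subsetP BF y) yF)//.
- by rewrite size_map -cardE card_powerset.
- move=> v /mapP[A _ ->]; exists (loc A) => //=.
  by rewrite /loc addn_gt0 muln_gt0 sparsity_gt0 chunk_gt0.
Qed.

End Construction.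

(** * Block complexity *)

Section Complexity.
Local Open Scope nat_scope.
Variable A : choiceType.

Fixpoint words (V : seq A) (n : nat) : seq (seq A) :=
  if n is m.+1 then [seq x :: v | x <- V, v <- words V m] else [:: [::]].

Lemma size_words V n : size (words V n) = size V ^ n.
Proof. by elim: n => //= n IH; rewrite size_allpairs IH expnS. Qed.

Lemma mem_words V v : {subset v <= V} -> v \in words V (size v).
Proof.
elim: v => [|x v IH] vV /=; first by rewrite mem_seq1.
apply: allpairs_f; first by rewrite vV// mem_head.
by apply: IH => y yv; rewrite vV// in_cons yv orbT.
Qed.

Lemma blocks_words (V : seq A) (w : nat -> A) n :
  (forall i, 0 < i -> w i \in V) -> blocks w n `<=` [set` words V n].
Proof.
move=> wV _ [i /= i0 <-]; rewrite -{2}(size_mkseq (fun j => w (i + j)) n).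
apply: mem_words => x /mapP[j _ ->]; apply: wV.
by rewrite (leq_trans i0)// leq_addr.
Qed.

Lemma finite_blocks (V : seq A) (w : nat -> A) n :
  (forall i, 0 < i -> w i \in V) -> finite_set (blocks w n).
Proof. by move=> wV; apply: sub_finite_set (blocks_words wV) _; exact: finite_seq. Qed.

Lemma complexity_le (w : nat -> A) n (s : seq (seq A)) :
  blocks w n `<=` [set` s] -> complexity w n <= size s.
Proof.
move=> ws; apply: uniq_leq_size; first exact: fset_uniq.
move=> v; rewrite in_fset_set ?inE; last exact: sub_finite_set ws (finite_seq s).
exact: ws.
Qed.

Lemma complexity_ge (w : nat -> A) n (s : seq (seq A)) :
  finite_set (blocks w n) -> uniq s -> {in s, forall v, blocks w n v} ->
  size s <= complexity w n.
Proof.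
move=> fw us sw; apply: uniq_leq_size => // v /sw wv.
by rewrite in_fset_set// inE.
Qed.

Lemma complexity_gt0 (w : nat -> A) n : finite_set (blocks w n) ->
  0 < complexity w n.
Proof.
move=> fw; apply: (complexity_ge (s := [:: mkseq (fun j => w (1 + j)) n])) => //.
by move=> v; rewrite mem_seq1 => /eqP->; exists 1.
Qed.

Lemma complexityD (w : nat -> A) m n :
  finite_set (blocks w m) -> finite_set (blocks w n) ->
  complexity w (m + n) <= complexity w m * complexity w n.
Proof.
move=> fm fn.
have := @complexity_le w (m + n)
  [seq u ++ v | u <- fset_set (blocks w m), v <- fset_set (blocks w n)].
rewrite size_allpairs; apply => _ [i /= i0 <-].
rewrite /mkseq iotaD map_cat add0n; apply: allpairs_f.
  by rewrite in_fset_set// inE; exists i.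
rewrite in_fset_set// inE; exists (i + m) => /=.
  by rewrite (leq_trans i0)// leq_addr.
rewrite /mkseq -[in RHS](addn0 m) iotaDl -map_comp.
by apply: eq_map => j /=; rewrite addnA.
Qed.

End Complexity.

(** * Subadditive sequences and topological entropy *)

Lemma fekete_cvg (R : realType) (u : nat -> R) :
  (forall n, 0 <= u n) -> (forall m n, u (m + n)%N <= u m + u n) ->
  cvgn (fun n => n%:R^-1 * u n).
Proof.
move=> u0 uD; pose E := [set n%:R^-1 * u n | n in [set n | (0 < n)%N]].
have E0 : lbound E 0 by move=> _ [n _ <-]; rewrite mulr_ge0// invr_ge0 ler0n.
(* The limit is the infimum of [u n / n] over positive [n]. *)
have hE : has_inf E by split; [exists (1%:R^-1 * u 1%N), 1%N|exists 0].
apply/cvg_ex; exists (inf E); apply/cvgrPdist_le => e e0.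
have e2 : 0 < e / 2 by rewrite divr_gt0.
have [_ [m /= m0 <-] mE] := inf_adherent e2 hE.
(* As [u] is nonnegative, this sum bounds [u r] for every remainder [r < m] at once. *)
pose B := \sum_(r < m) u r.
have uq q r : u (q * m + r)%N <= u r + q%:R * u m.
  elim: q => [|q IH]; first by rewrite mul0r addr0.
  rewrite mulSn -addnA (le_trans (uD _ _))// -natr1; lra.
near=> n.
have n0 : (0 < n)%N by near: n; exact: nbhs_infty_gt.
have n0R : 0 < n%:R :> R by rewrite ltr0n.
have m0R : 0 < m%:R :> R by rewrite ltr0n.
have lo : inf E <= n%:R^-1 * u n by apply: ge_inf; [exists 0|exists n].
have hi : n%:R^-1 * u n <= inf E + e.
  have un : u n <= B + (n %/ m)%:R * u m.
    rewrite {1}(divn_eq n m) (le_trans (uq _ _))// lerD2r.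
    rewrite /B (bigD1 (Ordinal (ltn_pmod n m0)))//= lerDl.
    by apply: sumr_ge0 => i _.
  have nB : B <= e / 2 * n%:R.
    rewrite -ler_pdivrMl//; near: n; exact: nbhs_infty_ger.
  have qn : (n %/ m)%:R * u m <= n%:R * (m%:R^-1 * u m).
    rewrite mulrA ler_wpM2r// ler_pdivlMr// -natrM ler_nat.
    exact: leq_divM.
  have : n%:R * (m%:R^-1 * u m) <= n%:R * (inf E + e / 2).
    by rewrite ler_wpM2l// ltW.
  rewrite ler_pdivrMl//; nra.
rewrite ler_norml; lra.
Unshelve. all: by end_near. Qed.

Section Entropy.
Variable R : realType.

Lemma log2_exp2 n : log2 (2%:R ^+ n : R) = n%:R.
Proof.
have l2 : ln (2 : R) != 0 by rewrite gt_eqF// ln_gt0// ltr1n.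
by rewrite /log2 lnXn// -[ln _ *+ n]mulr_natl mulfK.
Qed.

Lemma ler_log2 (x y : R) : 0 < x -> x <= y -> log2 x <= log2 y.
Proof.
move=> x0 xy; have y0 := lt_le_trans x0 xy.
by rewrite /log2 ler_wpM2r ?invr_ge0 ?ln_ge0 ?ler1n// ler_ln ?posrE.
Qed.

Lemma log2_ge0 (x : R) : 1 <= x -> 0 <= log2 x.
Proof. by move=> x1; rewrite divr_ge0// ln_ge0// ler1n. Qed.

Variables (A : choiceType) (w : nat -> A) (V : seq A).
Hypothesis wV : forall i, (0 < i)%N -> w i \in V.

Let complexity_gt0R n : 0 < (complexity w n)%:R :> R.
Proof. by rewrite ltr0n; apply: complexity_gt0; apply: finite_blocks wV. Qed.

(** Submultiplicativity of the complexity makes its logarithm subadditive. Convergence is what makes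
    the [limn] in [htop] a genuine limit. *)
Lemma htop_cvg : cvgn (fun n => n%:R^-1 * log2 (complexity w n)%:R : R).
Proof.
apply: fekete_cvg => [n|m n].
  by apply: log2_ge0; rewrite ler1n -(ltr0n R).
apply: (@le_trans _ _ (log2 ((complexity w m)%:R * (complexity w n)%:R))).
  apply: ler_log2 => //; rewrite -natrM ler_nat.
  by apply: complexityD; apply: finite_blocks wV.
by rewrite /log2 lnM ?posrE// mulrDl.
Qed.

Lemma htop_ge0 : 0 <= htop R w.
Proof.
apply: limr_ge htop_cvg _; apply: nearW => n.
by rewrite mulr_ge0 ?invr_ge0// log2_ge0// ler1n -(ltr0n R).
Qed.

Lemma htop_le (c : nat) : (size V <= 2 ^ c)%N -> htop R w <= c%:R.
Proof.
move=> Vc; apply: limr_le htop_cvg _; near=> n.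
have n0 : (0 < n)%N by near: n; exact: nbhs_infty_gt.
have e : n%:R * c%:R = log2 (2%:R ^+ (c * n)) :> R by rewrite log2_exp2 natrM mulrC.
rewrite ler_pdivrMl ?ltr0n// e; apply: ler_log2 => //.
rewrite -natrX ler_nat expnM (leq_trans (complexity_le (blocks_words wV)))//.
by rewrite size_words leq_exp2r.
Unshelve. all: by end_near. Qed.

(** As the limit exists, it can be computed along the lengths [p j], which tend to infinity. *)
Lemma htop_ge (c : R) (p : nat -> nat) : (forall j, (j < p j)%N) ->
  (forall j, exists2 k : nat, (p j)%:R * c <= k%:R &
     (2 ^ k <= complexity w (p j))%N) ->
  c <= htop R w.
Proof.
move=> jp pc.
have pinf : p x @[x --> \oo] --> \oo.
  apply/cvgnyPge => K; near=> j; rewrite (leq_trans _ (ltnW (jp j)))//.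
  by near: j; exact: nbhs_infty_ge.
have cv := cvg_comp _ _ pinf htop_cvg.
have -> : htop R w = limn (fun j => (p j)%:R^-1 * log2 (complexity w (p j))%:R).
  by apply/esym/cvg_lim.
apply: limr_ge; first by apply/cvg_ex; eexists; exact: cv.
apply: nearW => j; rewrite ler_pdivlMl; last by rewrite ltr0n (leq_trans _ (jp j)).
have [k pk kw] := pc j; rewrite (le_trans pk)// -(log2_exp2 k).
by apply: ler_log2; rewrite ?exprn_gt0// -natrX ler_nat.
Unshelve. all: by end_near. Qed.

End Entropy.

(** * Lower limits and the density of multiples of squares *)

Lemma limn_einf_gt0 (R : realType) (u : nat -> R) (c : R) : 0 < c ->
  (forall n, (0 < n)%N -> c <= u n) -> (0 < limn_einf (EFin \o u))%E.
Proof.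
move=> c0 cu; apply: (@lt_le_trans _ _ c%:E); first by rewrite lte_fin.
rewrite limn_einf_lim; apply: lime_ge; first exact: is_cvg_einfs.
near=> n; apply: le_ereal_inf_tmp => _ [m /= nm <-]; rewrite lee_fin cu//.
by rewrite (leq_trans _ nm)//; near: n; exact: nbhs_infty_gt.
Unshelve. all: by end_near. Qed.

Lemma sum_inv_squares_le (R : realFieldType) n :
  \sum_(2 <= m < n.+2) (m%:R ^+ 2)^-1 <= 3 / 4 :> R.
Proof.
case: n => [|n]; first by rewrite big_geq//; lra.
(* The term 1/4 is kept apart, and the later ones telescope through 1/m^2 <= 1/(m-1) - 1/m; the
   subtracted tail makes the induction close. *)
apply: (@le_trans _ _ (3 / 4 - n.+2%:R^-1)); last first.
  by rewrite gerBl invr_ge0.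
elim: n => [|n IH]; first by rewrite big_nat1; lra.
rewrite big_nat_recr//= (le_trans (lerD IH (lexx _)))//.
have -> : n.+3%:R = n.+2%:R + 1 :> R by rewrite natr1.
have x0 : 0 < n.+2%:R :> R by rewrite ltr0n.
move: (n.+2%:R : R) x0 => x x0.
rewrite -subr_ge0 (_ : _ - _ = (x * (x + 1) ^+ 2)^-1).
  by rewrite invr_ge0 mulr_ge0 ?exprn_ge0// ltW// addr_gt0.
by field; rewrite !lt0r_neq0// addr_gt0.
Qed.

Lemma count_square_multiples_le (R : realFieldType) (N : nat) :
  (count (fun n => has (fun m => m ^ 2 %| n)%N (iota 2 N)) (iota 1 N))%:R
    <= N%:R * (3 / 4) :> R.
Proof.
have := count_has_le (fun m n => m ^ 2 %| n)%N (iota 2 N) (iota 1 N).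
rewrite -(ler_nat R) => /le_trans; apply; rewrite natr_sum.
apply: (@le_trans _ _ (\sum_(m <- iota 2 N) N%:R * (m%:R ^+ 2)^-1)).
  rewrite [leLHS]big_seq [leRHS]big_seq; apply: ler_sum => m.
  rewrite mem_iota => /andP[m2 _].
  have m0 : (0 < m ^ 2)%N by rewrite expn_gt0 (ltnW m2).
  rewrite -natrX -[X in _ * X]mul1r.
  (* Divisibility is recast as a residue window of length 1. *)
  rewrite (eq_count (a2 := fun n => n %% m ^ 2 < 1)%N); last first.
    by move=> n; rewrite ltnS leqn0.
  apply: (@count_residue_le _ _ 1) => //; first exact: iota_uniq.
  move=> n; rewrite mem_iota add1n ltnS => /andP[n1 nN].
  rewrite ltnS leqn0 => mn; rewrite divn_gt0// dvdn_leq//=.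
  by rewrite ltnS leq_div2r.
rewrite -mulr_sumr ler_wpM2l//.
by have := sum_inv_squares_le R N; rewrite /index_iota -[N.+2]addn2 addnK.
Qed.

(** * Values and zeros of the generalized Möbius function *)

Section BFree.
Variables (a : nat -> int) (b : nat -> nat).

Lemma muB_range n : muB a b n \in [:: -1; 0; 1].
Proof.
by rewrite /muB /eta -signr_odd; case: odd; case: asboolP.
Qed.

Lemma muB_eq0 n : (muB a b n == 0) = `[< exists k, (b k %| n)%N >].
Proof. by rewrite /muB mulf_eq0 signr_eq0 /eta; case: asboolP. Qed.

Hypothesis b_ge2 : forall k, (2 <= b k)%N.
Hypothesis b_sqr : forall k, (b k)%:Z = a k ^+ 2.

(** A zero is a multiple of some [b k], the square of [|a k|], which is at least 2 because [b k]
    is. *)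
Lemma count_muB_eq0_le (R : realFieldType) (N : nat) :
  (count (fun n => muB a b n == 0) (iota 1 N))%:R <= N%:R * (3 / 4) :> R.
Proof.
apply: le_trans (count_square_multiples_le R N); rewrite ler_nat.
apply: sub_in_count => n; rewrite mem_iota add1n ltnS => /andP[n1 nN].
rewrite muB_eq0 => /asboolP[k bn].
have bE : b k = (`|a k| ^ 2)%N.
  by rewrite -abszX -b_sqr.
apply/hasP; exists `|a k|%N; last by rewrite -bE.
have := b_ge2 k; have := dvdn_leq n1 bn; rewrite mem_iota bE; nia.
Qed.

End BFree.

(** * Choice of the sparsity, correlation and comparison of entropies *)

Theorem corollary7p19 (R : realType) (a : nat -> int) (b : nat -> nat)
    (b_ge2 : forall k, (2 <= b k)%N)
    (b_sqr : forall k, (b k)%:Z = a k ^+ 2)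
    (a_coprime : forall k l, k <> l -> coprimez (a k) (a l))
    (eps : R) (eps_gt0 : 0 < eps) :
  let z := muB a b in
  exists t : nat -> int,
    (forall n, (0 < n)%N -> t n \in [:: -1; 0; 1]) /\
    toeplitz t /\
    (0 < limn_einf (fun N : nat =>
       ((N%:R^-1 * \sum_(1 <= n < N.+1) (t n * z n)%:~R : R)%:E)))%E /\
    (1 - eps) * htop R (fun n => z n ^+ 2) <= htop R t.
Proof.
(* The summand 32 brings the mismatch frequency [2 / C.+1] below 1/16; the other one makes the
   entropy loss [1 / C.+1] at most [eps]. *)
move=> z; pose C := (32 + Num.bound eps^-1)%N; exists (toeplitz_approx C z).
have zV n : z n \in [:: -1; 0; 1] by exact: muB_range.
have tV n : toeplitz_approx C z n \in [:: -1; 0; 1].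
  by apply: toeplitz_approx_range => // _ /[!inE] /orP[]/eqP->; rewrite eqxx ?orbT.
split; first by [].
split; first exact: toeplitz_toeplitz_approx.
split.
  (* The constant is 1 - 3/4 - 2/16: zeros of [z] cost 1 each, and mismatches cost 2 each since a
     product may drop from 1 to -1. *)
  apply: (@limn_einf_gt0 _ _ (8%:R^-1)) => // N N0.
  rewrite ler_pdivlMl ?ltr0n//.
  have lower n : ((toeplitz_approx C z n * z n)%:~R : R) >=
      1 - (z n == 0)%:R - 2 * (toeplitz_approx C z n != z n)%:R.
    have [->|_] := eqVneq (toeplitz_approx C z n) (z n).
      by have := zV n; rewrite !inE => /or3P[] /eqP->; rewrite /= ?eqxx; lra.
    have := zV n; have := tV n.
    rewrite !inE => /or3P[] /eqP-> /or3P[] /eqP->; rewrite /= ?eqxx; lra.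
  have countE (P : pred nat) :
      \sum_(1 <= n < N.+1) (P n)%:R = (count P (iota 1 N))%:R :> R.
    rewrite -natr_sum /index_iota subSS subn0 -sum1_count [in RHS]big_mkcond/=.
    by congr _%:R; apply: eq_bigr => n _; case: (P n).
  apply: le_trans (ler_sum _ (fun n _ => lower n)).
  rewrite !sumrB -mulr_sumr !countE sumr_const_nat subn1/=.
  have zN := count_muB_eq0_le b_ge2 b_sqr R N.
  have tN : (count (fun n => toeplitz_approx C z n != z n) (iota 1 N))%:R
      <= N%:R * 16%:R^-1 :> R.
    apply: le_trans (count_mismatch C z R N) _.
    rewrite ler_wpM2l// ler_pdivrMr ?ltr0n// ler_pdivlMl ?ltr0n//.
    by rewrite -natrM ler_nat.
  rewrite -/z in zN; lra.
have ? : C.+1%:R^-1 <= eps.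
  rewrite invf_ple ?posrE ?ltr0n// (le_trans (ltW (archi_boundP _)))//.
    by rewrite invr_ge0 ltW.
  by rewrite ler_nat ltnW// ltnS leq_addl.
have ? : C.+1%:R^-1 <= 1 :> R by rewrite invf_le1 ?ltr0n// ler1n.
have ht : 1 - C.+1%:R^-1 <= htop R (toeplitz_approx C z).
  apply: (htop_ge (fun n _ => tV n) (@lt_period C)) => j.
  exists #|free_set C j|; first exact: card_free_set.
  have [s [us <- sw]] := toeplitz_approx_words C z j.
  by apply: complexity_ge => //; apply: (finite_blocks (V := [:: -1; 0; 1])).
have z2V n : (0 < n)%N -> z n ^+ 2 \in [:: 0; 1].
  by move=> _; have := zV n; rewrite !inE => /or3P[] /eqP->.
have h0 := htop_ge0 R z2V.
have h1 := @htop_le R _ _ _ z2V 1%N isT.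
apply: le_trans ht.
(* For [eps <= 1] the bound 1 on the entropy of the square is used; for larger [eps] the left side
   is at most 0. *)
have [e1|/ltW e1] := lerP eps 1.
  by rewrite (le_trans (ler_piMr _ h1)) ?subr_ge0// lerD2l lerN2.
by rewrite (le_trans (mulr_le0_ge0 _ h0)) ?subr_le0// subr_ge0.
Qed.
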